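(* Let $d\ge2$, $N,M\ge1$ be integers and let $|\psi\rangle,|\phi\rangle\in\mathbb{C}^d$ be independent Haar-random pure states with overlap $c=|\langle\psi|\phi\rangle|^2$. For the estimate-and-estimate strategy, the estimator of $c$ minimizing the global mean square error (the posterior mean of $c$ given the outcomes) depends on the outcomes only through the overlap $w=|\langle\phi_V|\psi_W\rangle|^2$ of the two estimated states and equals $$\frac{d+M+N+MN\,w}{(d+M)(d+N)},$$ and the corresponding minimum global mean square error is $$v_{ee}=\frac{(d-1)(d+M+N)\left(d^2+2MN+d(M+N)\right)}{d(d+1)(d+M)^2(d+N)^2} .$$ Moreover $v_{ee}\to\frac{(d-1)(d+2N)}{d(d+1)(d+N)^2}$ as $M\to\infty$ with $N$ fixed, and $v_{ee}\sim\frac{8(d-1)}{d(d+1)(M+N)}$ as $M+N\to\infty$ with $M-N$ fixed.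
   Context: Estimate-and-estimate strategy: given $N$ copies of $|\psi\rangle$ and $M$ copies of $|\phi\rangle$, independent covariant measurements are performed on $|\phi\rangle^{\otimes M}$ and on $|\psi\rangle^{\otimes N}$, producing estimates $|\phi_V\rangle=V|0\rangle$ and $|\psi_W\rangle=W|0\rangle$, $V,W\in SU(d)$, with joint probability density $$\binom{M+d-1}{d-1}|\langle\phi_V|\phi\rangle|^{2M}\binom{N+d-1}{d-1}|\langle\psi_W|\psi\rangle|^{2N}$$ with respect to the product $dV\,dW$ of normalized Haar measures ($|0\rangle$ a fixed unit vector). The global mean square error of an estimator is the expectation, over the random states and the outcomes, of its squared deviation from $c$. *)

(* Defs.v *)
From HB Require Import structures.
From mathcomp Require Import all_boot all_order all_algebra.
From mathcomp Require Import all_classical all_reals all_analysis.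
From mathcomp Require Import complex.

Set Implicit Arguments.
Unset Strict Implicit.
Unset Printing Implicit Defensive.

Import Order.TTheory GRing.Theory Num.Theory.
Import numFieldNormedType.Exports.

Local Open Scope classical_set_scope.
Local Open Scope complex_scope.
Local Open Scope sesquilinear_scope.
Local Open Scope ring_scope.

(* Kets are column vectors 'cV[R[i]]_d over the complex numbers R[i]. *)

Record SU (R : realType) (d : nat) := MkSU {
  SUmx :> 'M[R[i]]_d ;
  SUmxP : (SUmx \is unitarymx) && (\det SUmx == 1) }.

Section special_unitary_group.
Variables (R : realType) (d : nat).

HB.instance Definition _ := [isSub of SU R d for @SUmx R d].
HB.instance Definition _ := [Choice of SU R d by <:].

Lemma SU1_subproof :
  ((1%:M : 'M[R[i]]_d) \is unitarymx) && (\det (1%:M : 'M[R[i]]_d) == 1).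
Proof.
by rewrite det1 eqxx andbT; apply/unitarymxP; rewrite trmx1 map_mx1 mulmx1.
Qed.

Definition SU1 : SU R d := MkSU SU1_subproof.

Lemma SUmul_subproof (U V : SU R d) :
  (U *m V \is unitarymx) && (\det (U *m V) == 1).
Proof.
have /andP[uU /eqP dU] := SUmxP U; have /andP[uV /eqP dV] := SUmxP V.
by rewrite mul_unitarymx//= det_mulmx dU dV mulr1.
Qed.

Definition SUmul (U V : SU R d) : SU R d := MkSU (SUmul_subproof U V).

HB.instance Definition _ := isPointed.Build (SU R d) SU1.

(* Subspace topology of 'M[R[i]]_d and its Borel sigma-algebra.  The alias
   R[i]^o (convertible to R[i]) carries the topology of the modulus. *)
HB.instance Definition _ := Topological.copy (SU R d)
  (initial_topology (@SUmx R d : SU R d -> 'M[R[i]^o]_d)).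
HB.instance Definition _ := Measurable.copy (SU R d)
  (g_sigma_algebraType (@open (SU R d))).

End special_unitary_group.

(* By uniqueness of the normalized Haar measure, this predicate on Borel
   probability measures characterizes it. *)
Definition is_haar (R : realType) (d : nat) (mu : probability (SU R d) R) :=
  forall (U : SU R d) (A : set (SU R d)),
    measurable A -> mu (SUmul U @^-1` A) = mu A.

Definition braket (R : realType) (d : nat) (phi psi : 'cV[R[i]]_d) : R[i] :=
  (phi ^t* *m psi) 0 0.

Definition unit_ket (R : realType) (d : nat) (psi : 'cV[R[i]]_d) : Prop :=
  braket psi psi = 1.

Definition overlap (R : realType) (d : nat) (phi psi : 'cV[R[i]]_d) : R :=
  Normc.normc (braket phi psi) ^+ 2.

Section estimate_and_estimate.
Variables (R : realType) (d : nat) (haar : probability (SU R d) R).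
Variables (e0 : 'cV[R[i]]_d) (N M : nat).

(* The pure state U|0>; it is Haar-random when U is drawn from haar. *)
Definition ket (U : SU R d) : 'cV[R[i]]_d := U *m e0.

(* A pair s : SU * SU encodes the states psi = s.1|0> and phi = s.2|0>, and a
   pair o : SU * SU the outcomes V = o.1 (measurement on the M copies of phi)
   and W = o.2 (measurement on the N copies of psi). *)

Definition outcome_density (s o : SU R d * SU R d) : R :=
  ('C(M + d - 1, d - 1)%:R * overlap (ket o.1) (ket s.2) ^+ M) *
  ('C(N + d - 1, d - 1)%:R * overlap (ket o.2) (ket s.1) ^+ N).

Definition state_overlap (s : SU R d * SU R d) : R :=
  overlap (ket s.1) (ket s.2).

(* Bayes' rule: the posterior density of s given o is proportional to
   outcome_density s o with respect to the prior haar \x haar. *)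
Definition posterior_mean (o : SU R d * SU R d) : R :=
  (\int[(haar \x haar)%E]_s (state_overlap s * outcome_density s o)) /
  (\int[(haar \x haar)%E]_s outcome_density s o).

Definition gmse (f : SU R d * SU R d -> R) : \bar R :=
  (\int[haar \x haar]_s \int[haar \x haar]_o
     (outcome_density s o * (f o - state_overlap s) ^+ 2)%:E)%E.

Definition estimator : set (SU R d * SU R d -> R) :=
  [set f | measurable_fun setT f].

Definition min_gmse : \bar R := ereal_inf (gmse @` estimator).

End estimate_and_estimate.

(* Main.v *)
(* The posterior mean and the risk reduce to moments of squared amplitudes
   |<r, U e0>|^2 under the Haar measure.  Every row vector r is a multiple of the
   first row of some element of SU(d) (d >= 2), so left invariance gives
     int |<r, U e0>|^(2m) dU = a_m ||r||^(2m).
   Comparing the t^2 coefficients of this identity along r = v + t w and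
   r = v + i t w, for unit v and w, and adding the two, yields
     (m+1) int |<v, U e0>|^(2m) |<w, U e0>|^2 dU
       = a_(m+1) (1 + m |<v, w>|^2),
   and summing over w in an orthonormal basis gives
   (m+1) a_m = (d+m) a_(m+1), i.e. a_m = 1 / C(m+d-1, d-1).  Hence the outcome
   density has both marginals equal to 1, and two successive integrations give
   the posterior mean h.  The risk of an estimator f is that of h plus
   int (f - h)^2, and the risk of h is E[c^2] - E[h^2]. *)

From HB Require Import structures.
Require Import Defs.
From mathcomp Require Import all_boot all_order all_algebra.
From mathcomp Require Import all_classical all_reals all_analysis.
From mathcomp Require Import measurable_realfun complex ring lra.

Import Order.TTheory GRing.Theory Num.Theory.
Import numFieldNormedType.Exports.

Local Open Scope classical_set_scope.
Local Open Scope complex_scope.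
Local Open Scope sesquilinear_scope.
Local Open Scope ring_scope.

Set Implicit Arguments.
Unset Strict Implicit.
Unset Printing Implicit Defensive.

(** * Bounded measurable functions *)

Section bounded_measurable.
Context {disp} {T : measurableType disp} {R : realType}.
Implicit Types f g : T -> R.

(** On a probability space this class is an algebra of integrable functions, so integrability side
    conditions reduce to closure properties. *)
Definition bmfun f := measurable_fun setT f /\ exists K, forall x, `|f x| <= K.

Lemma bmfun_cst c : bmfun (fun=> c).
Proof. by split=> //; exists `|c|. Qed.

Lemma bmfunD f g : bmfun f -> bmfun g -> bmfun (fun x => f x + g x).
Proof.
move=> [mf [K fK]] [mg [L gL]]; split; first exact: measurable_funD.
by exists (K + L) => x; rewrite (le_trans (ler_normD _ _))// lerD.
Qed.

Lemma bmfunM f g : bmfun f -> bmfun g -> bmfun (fun x => f x * g x).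
Proof.
move=> [mf [K fK]] [mg [L gL]]; split; first exact: measurable_funM.
by exists (K * L) => x; rewrite normrM ler_pM.
Qed.

Lemma bmfunN f : bmfun f -> bmfun (fun x => - f x).
Proof.
move=> bf; rewrite (_ : (fun x => _) = (fun x => -1 * f x)).
  exact: bmfunM (bmfun_cst _) bf.
by apply/funext => x; rewrite mulN1r.
Qed.

Lemma bmfunB f g : bmfun f -> bmfun g -> bmfun (fun x => f x - g x).
Proof. by move=> bf bg; apply: bmfunD => //; exact: bmfunN. Qed.

Lemma bmfunX f n : bmfun f -> bmfun (fun x => f x ^+ n).
Proof.
move=> bf; elim: n => [|n IH]; first exact: bmfun_cst.
rewrite (_ : (fun x => _) = (fun x => f x * f x ^+ n)); first exact: bmfunM.
by apply/funext => x; rewrite exprS.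
Qed.

Lemma bmfun_sum (I : Type) (r : seq I) (F : I -> T -> R) :
  (forall i, bmfun (F i)) -> bmfun (fun x => \sum_(i <- r) F i x).
Proof.
move=> bF; elim: r => [|i r IH].
  by under eq_fun do rewrite big_nil; exact: bmfun_cst.
by under eq_fun do rewrite big_cons; exact: bmfunD.
Qed.

Variable P : probability T R.

Lemma bmfun_integrable f : bmfun f -> P.-integrable setT (EFin \o f).
Proof.
move=> [mf [K fK]]; apply: measurable_bounded_integrable => //.
  by rewrite -ge0_fin_numE ?fin_num_measure.
exists K; split; first exact: num_real.
by move=> L KL x _; exact: le_trans (fK x) (ltW KL).
Qed.

Lemma Rintegral_bmfunD f g : bmfun f -> bmfun g ->
  \int[P]_x (f x + g x) = \int[P]_x f x + \int[P]_x g x.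
Proof. by move=> bf bg; apply: RintegralD => //; exact: bmfun_integrable. Qed.

Lemma Rintegral_bmfunZl c f : bmfun f ->
  \int[P]_x (c * f x) = c * \int[P]_x f x.
Proof. by move=> bf; apply: RintegralZl => //; exact: bmfun_integrable. Qed.

Lemma Rintegral_bmfun_sum (I : Type) (r : seq I) (F : I -> T -> R) :
  (forall i, bmfun (F i)) ->
  \int[P]_x (\sum_(i <- r) F i x) = \sum_(i <- r) \int[P]_x F i x.
Proof.
move=> bF; elim: r => [|i r IH].
  under eq_Rintegral do rewrite big_nil.
  by rewrite big_nil Rintegral_cst// mul0r.
under eq_Rintegral do rewrite big_cons.
by rewrite big_cons Rintegral_bmfunD ?IH//; exact: bmfun_sum.
Qed.

Lemma Rintegral_probability_cst c : \int[P]_x c = c.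
Proof.
rewrite Rintegral_cst// -[RHS]mulr1; congr (_ * _).
exact: (congr1 fine (probability_setT P)).
Qed.

Lemma EFin_Rintegral_bmfun f : bmfun f ->
  (\int[P]_x f x)%:E = (\int[P]_x (f x)%:E)%E.
Proof.
move=> /bmfun_integrable fi; rewrite /Rintegral fineK//.
exact: integrable_fin_num.
Qed.

Lemma bmfun_coefM (p q : T -> {poly R}) :
  (forall k, bmfun (fun x => (p x)`_k)) ->
  (forall k, bmfun (fun x => (q x)`_k)) ->
  forall k, bmfun (fun x => (p x * q x)`_k).
Proof.
move=> bp bq k; under eq_fun do rewrite coefM.
by apply: bmfun_sum => i; exact: bmfunM.
Qed.

Lemma bmfun_coefX (p : T -> {poly R}) n :
  (forall k, bmfun (fun x => (p x)`_k)) ->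
  forall k, bmfun (fun x => (p x ^+ n)`_k).
Proof.
move=> bp; elim: n => [|n IH] k.
  by under eq_fun do rewrite expr0 coef1; exact: bmfun_cst.
by under eq_fun do rewrite exprS; exact: bmfun_coefM.
Qed.

(** In characteristic 0 the naturals below [size (p - q)] are that many distinct roots of
    [p - q]. *)
Lemma polyP_horner_num (p q : {poly R}) : (forall t, p.[t] = q.[t]) -> p = q.
Proof.
move=> pq; apply/eqP; rewrite -subr_eq0; apply/eqP.
apply: (@roots_geq_poly_eq0 _ _ [seq i%:R | i <- iota 0 (size (p - q))]).
- by apply/allP => _ /mapP[i _ ->]; rewrite rootE !hornerE pq subrr.
- by rewrite map_inj_uniq ?iota_uniq//; exact: mulrIn (oner_neq0 _).
- by rewrite size_map size_iota.
Qed.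

(** The uniform degree bound makes [p x] a finite sum, so integrating coefficientwise gives a
    polynomial that agrees with [q] at every [t]. This is what allows the [t^2] coefficients to be
    compared under the integral. *)
Lemma Rintegral_coef (p : T -> {poly R}) (q : {poly R}) n :
  (forall k, bmfun (fun x => (p x)`_k)) -> (forall x, (size (p x) <= n)%N) ->
  (forall t, \int[P]_x (p x).[t] = q.[t]) ->
  forall k, \int[P]_x (p x)`_k = q`_k.
Proof.
move=> bp sp pq k.
have <- : \poly_(i < n) (\int[P]_x (p x)`_i) = q.
  apply: polyP_horner_num => t; rewrite -pq horner_poly.
  under [RHS]eq_Rintegral do rewrite (horner_coef_wide _ (sp _)).
  rewrite Rintegral_bmfun_sum; last first.
    by move=> i; exact: bmfunM (bp i) (bmfun_cst _).
  apply: eq_bigr => i _; under [RHS]eq_Rintegral do rewrite mulrC.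
  by rewrite Rintegral_bmfunZl// mulrC.
rewrite coef_poly; case: ltnP => // nk.
under eq_Rintegral do rewrite nth_default ?(leq_trans (sp _) nk)//.
by rewrite Rintegral_cst// mul0r.
Qed.

End bounded_measurable.

Lemma bmfun_comp d1 d2 (T1 : measurableType d1) (T2 : measurableType d2)
    (R : realType) (h : T1 -> T2) (f : T2 -> R) :
  measurable_fun setT h -> bmfun f -> bmfun (f \o h).
Proof.
move=> mh [mf [K fK]]; split; first exact: measurableT_comp.
by exists K => x; exact: fK.
Qed.

(** * Fubini for bounded measurable functions *)

Section fubini_bmfun.
Context d1 d2 (T1 : measurableType d1) (T2 : measurableType d2) (R : realType).
Variables (P1 : probability T1 R) (P2 : probability T2 R).
Variable f : T1 * T2 -> R.
Hypothesis bf : bmfun f.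

Lemma bmfun_pair1 x : bmfun (fun y => f (x, y)).
Proof. exact: (bmfun_comp (pair1_measurable x) bf). Qed.

Lemma bmfun_pair2 y : bmfun (fun x => f (x, y)).
Proof. exact: (bmfun_comp (pair2_measurable y) bf). Qed.

Lemma Rintegral_fubini1 :
  \int[(P1 \x P2)%E]_z f z = \int[P1]_x \int[P2]_y f (x, y).
Proof.
rewrite /Rintegral -integral12_prod_meas1; last exact: bmfun_integrable.
congr fine; apply: eq_integral => x _.
by rewrite /fubini_F/= -EFin_Rintegral_bmfun//; exact: bmfun_pair1.
Qed.

Lemma Rintegral_fubini2 :
  \int[(P1 \x P2)%E]_z f z = \int[P2]_y \int[P1]_x f (x, y).
Proof.
rewrite /Rintegral -integral21_prod_meas1; last exact: bmfun_integrable.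
congr fine; apply: eq_integral => y _.
by rewrite /fubini_G/= -EFin_Rintegral_bmfun//; exact: bmfun_pair2.
Qed.

End fubini_bmfun.

(** * Borel structure of SU(d) *)

Section SU_borel.
Variables (R : realType) (d : nat).

Lemma open_measurable_SU (A : set (SU R d)) : open A -> measurable A.
Proof. exact: sub_sigma_algebra. Qed.

Lemma continuous_measurable_SU (f : SU R d -> R) :
  continuous f -> measurable_fun setT f.
Proof.
move=> /continuousP cf.
apply: (measurability _ (RGenOpens.measurableE R)).
move=> _ [_ [a [b ->]] <-].
rewrite setTI; apply: open_measurable_SU; apply: cf; exact: interval_open.
Qed.

Lemma SUmx_continuous : continuous (@SUmx R d : SU R d -> 'M[R[i]^o]_d).
Proof. exact: initial_continuous. Qed.

Lemma SU_coord_continuous (i j : 'I_d) :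
  continuous (fun U : SU R d => (U : 'M[R[i]]_d) i j : R[i]^o).
Proof.
move=> U; apply: (@continuous_comp _ _ _ (@SUmx R d : SU R d -> 'M[R[i]^o]_d)
  (fun M : 'M[R[i]^o]_d => M i j)).
  exact: SUmx_continuous.
exact: coord_continuous.
Qed.

Lemma Re_continuous : continuous (@complex.Re R : R[i]^o -> R).
Proof.
move=> z A /nbhs_ballP[e /= e0 eA].
(* The norm of [R[i]^o] takes values in [R[i]], so the radius is embedded there; the claim is then
   [|Re z| <= |z|]. *)
have ec : 0 < e%:C by rewrite ltcR.
apply: filterS (nbhsx_ballx (z : R[i]^o) _ ec) => w /=.
rewrite -ball_normE /= => zw; apply: eA; rewrite -ball_normE /= -raddfB.
move: zw; rewrite normc_def ltcR; apply: le_lt_trans.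
by rewrite -sqrtr_sqr ler_wsqrtr// lerDl sqr_ge0.
Qed.

Lemma Im_continuous : continuous (@complex.Im R : R[i]^o -> R).
Proof.
move=> z A /nbhs_ballP[e /= e0 eA].
have ec : 0 < e%:C by rewrite ltcR.
apply: filterS (nbhsx_ballx (z : R[i]^o) _ ec) => w /=.
rewrite -ball_normE /= => zw; apply: eA; rewrite -ball_normE /= -raddfB.
move: zw; rewrite normc_def ltcR; apply: le_lt_trans.
by rewrite -sqrtr_sqr ler_wsqrtr// lerDr sqr_ge0.
Qed.

Lemma measurable_SU_Re i j :
  measurable_fun setT (fun U : SU R d => complex.Re (U i j)).
Proof.
apply: continuous_measurable_SU => U.
apply: (@continuous_comp _ _ _ (fun U : SU R d => U i j : R[i]^o)
  (@complex.Re R : R[i]^o -> R)).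
  exact: SU_coord_continuous.
exact: Re_continuous.
Qed.

Lemma measurable_SU_Im i j :
  measurable_fun setT (fun U : SU R d => complex.Im (U i j)).
Proof.
apply: continuous_measurable_SU => U.
apply: (@continuous_comp _ _ _ (fun U : SU R d => U i j : R[i]^o)
  (@complex.Im R : R[i]^o -> R)).
  exact: SU_coord_continuous.
exact: Im_continuous.
Qed.

Lemma mulmx_continuous (A : 'M[R[i]]_d) :
  continuous ((fun M => A *m M) : 'M[R[i]^o]_d -> 'M[R[i]^o]_d).
Proof.
pose T := 'M[R[i]^o]_d.
move=> M B [P MP PB].
have FM : Filter (nbhs (M : T)) := nbhs_filter (M : T).
(* Matrix neighbourhoods are entrywise, and finitely many entries reduce the goal to continuity of a
   single entry of the product. *)
have H : nbhs (M : T) [set N : T | forall i j, P i j ((A *m N) i j)].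
  have H1 := @filter_forall _ _
    (fun i => [set N : T | forall j, P i j ((A *m N) i j)]) _ FM.
  apply: H1 => i.
  have H2 := @filter_forall _ _
    (fun j => [set N : T | P i j ((A *m N) i j)]) _ FM.
  apply: H2 => j.
  suff H : continuous_at (M : T) (fun N : T => (A *m N) i j : R[i]^o).
    exact: H (MP i j).
  have -> : (fun N : T => (A *m N) i j : R[i]^o) =
      \sum_k (fun N : T => A i k * N k j : R[i]^o).
    by apply/funext => N; rewrite fct_sumE mxE.
  rewrite /continuous_at fct_sumE.
  have cAN k : continuous (fun N : T => A i k * N k j : R[i]^o).
    move=> N; apply: (@cvgMl_tmp _ _ _ (@nbhs_filter _ (N : T))
      (fun N : T => N k j : R[i]^o)).
    exact: coord_continuous.
  exact: (@continuous_big (R[i]^o) 'I_d +%R 0 xpredT (@add_continuous _) T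
    (index_enum 'I_d) (fun k (N : T) => A i k * N k j : R[i]^o)
    (fun k _ => cAN k)).
exact: (@filterS _ _ FM _ _ (fun N HN => PB _ HN) H).
Qed.

(** Preimages of open sets suffice, and an open set of [SU R d] is the trace of an open set of
    matrices, whose preimage under left multiplication is open. *)
Lemma measurable_SUmul (V : SU R d) : measurable_fun setT (SUmul V).
Proof.
apply: (measurability (open : set (set (SU R d)))) => // _ [_ [B oB <-] <-].
rewrite setTI; apply: open_measurable_SU.
exists ((fun M : 'M[R[i]^o]_d => (V : 'M[R[i]]_d) *m M) @^-1` B) => //.
by move/continuousP: (@mulmx_continuous V); apply.
Qed.

End SU_borel.

(** * Squared modulus of complex numbers *)

Section sqmod.
Variable R : realType.
Implicit Types z w : R[i].

Definition sqmod z : R := complex.Re z ^+ 2 + complex.Im z ^+ 2.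

Lemma sqmodE z : (sqmod z)%:C = z * z^*%C.
Proof. by case: z => a b; rewrite /sqmod /=; simpc; congr (_ +i* _); ring. Qed.

Lemma conjCE z : Num.conj z = z^*%C.
Proof. by []. Qed.

Lemma normc_sqr z : Normc.normc z ^+ 2 = sqmod z.
Proof. by case: z => a b; rewrite /= sqr_sqrtr// addr_ge0 ?sqr_ge0. Qed.

Lemma sqmod_ge0 z : 0 <= sqmod z.
Proof. by rewrite addr_ge0 ?sqr_ge0. Qed.

Lemma sqmodM z w : sqmod (z * w) = sqmod z * sqmod w.
Proof. by case: z w => [a b] [c d]; rewrite /sqmod /=; ring. Qed.

Lemma sqmodJ z : sqmod z^*%C = sqmod z.
Proof. by case: z => a b; rewrite /sqmod /= sqrrN. Qed.

Lemma sqmod1 : sqmod 1 = 1.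
Proof. by rewrite /sqmod /= expr0n addr0 expr1n. Qed.

(** A real step [t] exposes [Re] of the cross term, an imaginary step ([sqmodDi]) its [Im]; using
    both recovers its full squared modulus. *)
Lemma sqmodDr z w t : sqmod (z + t%:C * w) =
  sqmod z + complex.Re (z * w^*%C) * 2 * t + sqmod w * t ^+ 2.
Proof. by case: z w => [a b] [c d]; rewrite /sqmod /=; simpc => /=; ring. Qed.

Lemma sqmodDi z w t : sqmod (z + (t *i) * w) =
  sqmod z + complex.Im (z * w^*%C) * 2 * t + sqmod w * t ^+ 2.
Proof. by case: z w => [a b] [c d]; rewrite /sqmod /=; simpc => /=; ring. Qed.

End sqmod.

(** * Coefficients of powers of a quadratic polynomial *)

Section coefficient.
Variable R : realType.
Implicit Types a b c : R.

Definition quad a b c : {poly R} := a%:P + b%:P * 'X + c%:P * 'X^2.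

Lemma size_quad a b c : (size (quad a b c) <= 3)%N.
Proof.
apply/leq_sizeP => j; rewrite /quad !coefD !coefCM coefC coefX coefXn.
by case: j => [|[|[|j]]]//= _; rewrite !mulr0 !addr0.
Qed.

Lemma horner_quad a b c t : (quad a b c).[t] = a + b * t + c * t ^+ 2.
Proof. by rewrite /quad !hornerE. Qed.

Lemma coef_quad a b c k : (quad a b c)`_k = [:: a; b; c]`_k.
Proof.
rewrite /quad !coefD !coefCM coefC coefX coefXn.
case: k => [|[|[|k]]]//=; rewrite ?mulr0 ?mulr1 ?addr0 ?add0r//.
by rewrite nth_default.
Qed.

(** A [t^2] term takes [c] from one of the [m+1] factors or [b] from two of them. For [m = 0] the
    binomial vanishes, so the truncated [m.-1] is harmless. *)
Lemma coef2_quadX a b c m : ((quad a b c) ^+ m.+1)`_2 =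
  m.+1%:R * a ^+ m * c + 'C(m.+1, 2)%:R * a ^+ m.-1 * b ^+ 2.
Proof.
(* The induction on the [t^2] coefficient needs the two lower coefficients as well. *)
suff: [/\ ((quad a b c) ^+ m.+1)`_0 = a ^+ m.+1,
          ((quad a b c) ^+ m.+1)`_1 = m.+1%:R * a ^+ m * b &
          ((quad a b c) ^+ m.+1)`_2 =
            m.+1%:R * a ^+ m * c + 'C(m.+1, 2)%:R * a ^+ m.-1 * b ^+ 2].
  by case.
elim: m => [|m [IH0 IH1 IH2]].
  by rewrite expr1 !coef_quad/= bin_small//; split; ring.
rewrite exprS !coefM !big_ord_recl !big_ord0 /= !subn0 !coef_quad/=.
rewrite /bump /= !addn0 ?add1n ?subSS ?subn0 IH0 IH1 IH2; split.
- by rewrite -exprS; ring.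
- by rewrite (exprS a m) -[in RHS]natr1; ring.
- rewrite (_ : 'C(m.+2, 2) = 'C(m.+1, 2) + m.+1)%N; last by rewrite binS bin1.
  rewrite natrD; case: m {IH0 IH1 IH2} => [|m];
    rewrite ?[in 'C(1, 2)]bin_small//=.
    ring.
  rewrite !exprS -[m.+3%:R]natr1; move: (_%:R) (_%:R) (a ^+ m) => x y z; ring.
Qed.

Lemma size_quadX a b c m : (size ((quad a b c) ^+ m) <= (2 * m).+1)%N.
Proof.
rewrite (leq_trans (size_poly_exp_leq _ _))// ltnS leq_mul//.
by move: (size_quad a b c); case: (size (quad a b c)).
Qed.

End coefficient.

(** * Row vectors as linear forms on kets *)

Section rows.
Variables (R : realType) (d : nat).
Implicit Types (r v w : 'rV[R[i]]_d) (x : 'cV[R[i]]_d).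

(** Rows replace bras so that the amplitude is linear, not antilinear, in [r]; the bra of [phi] is
    the row [phi ^t*]. *)
Definition amp r x : R[i] := (r *m x) 0 0.
Definition rdot v w : R[i] := amp v (w^t*).
Definition rsq r : R := \sum_j sqmod (r 0 j).

Lemma ampDl v w x (z : R[i]) : amp (v + z *: w) x = amp v x + z * amp w x.
Proof. by rewrite /amp mulmxDl -scalemxAl !mxE. Qed.

Lemma rsqE r : (rsq r)%:C = rdot r r.
Proof.
rewrite /rsq rmorph_sum /rdot /amp mxE; apply: eq_bigr => j _.
by rewrite !mxE; exact: sqmodE.
Qed.

Lemma rsqZ (z : R[i]) r : rsq (z *: r) = sqmod z * rsq r.
Proof.
by rewrite /rsq mulr_sumr; apply: eq_bigr => j _; rewrite mxE sqmodM.
Qed.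

Lemma rdotE v w : rdot v w = \sum_j v 0 j * (w 0 j)^*%C.
Proof. by rewrite /rdot /amp mxE; apply: eq_bigr => j _; rewrite !mxE. Qed.

Lemma rsqDr v w t : rsq (v + t%:C *: w) =
  rsq v + complex.Re (rdot v w) * 2 * t + rsq w * t ^+ 2.
Proof.
rewrite rdotE raddf_sum /rsq !mulr_suml -!big_split/=.
by apply: eq_bigr => j _; rewrite !mxE sqmodDr.
Qed.

Lemma rsqDi v w t : rsq (v + (t *i) *: w) =
  rsq v + complex.Im (rdot v w) * 2 * t + rsq w * t ^+ 2.
Proof.
rewrite rdotE raddf_sum /rsq !mulr_suml -!big_split/=.
by apply: eq_bigr => j _; rewrite !mxE sqmodDi.
Qed.

Lemma rsq_delta (j : 'I_d) : rsq (delta_mx 0 j) = 1.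
Proof.
rewrite /rsq (bigD1 j)//= mxE !eqxx/= sqmod1 big1 ?addr0// => k kj.
by rewrite mxE (negbTE kj) andbF /sqmod /= expr0n addr0.
Qed.

Lemma amp_delta (j : 'I_d) x : amp (delta_mx 0 j) x = x j 0.
Proof. by rewrite /amp -rowE mxE. Qed.

Lemma rdot_delta v (j : 'I_d) : rdot v (delta_mx 0 j) = v 0 j.
Proof.
rewrite rdotE (bigD1 j)//= big1 ?addr0 => [|k kj].
  by rewrite mxE !eqxx conjc_nat mulr1.
by rewrite mxE (negbTE kj) andbF conjc_nat mulr0.
Qed.

Lemma rsq_row_unitary (U : 'M[R[i]]_d) i : U \is unitarymx -> rsq (row i U) = 1.
Proof.
move=> /unitarymxP /matrixP/(_ i i); rewrite !mxE eqxx => UU.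
apply: complexI; rewrite rsqE rdotE; transitivity (1%:R : R[i]) => //.
rewrite -UU.
by apply: eq_bigr => j _; rewrite !mxE.
Qed.

Lemma sqmod_SU_le1 (U : SU R d) i j : sqmod (U i j) <= 1.
Proof.
have /andP[uU _] := SUmxP U.
have := rsq_row_unitary i uU; rewrite /rsq (bigD1 j)//= mxE => <-.
by rewrite lerDl sumr_ge0// => k _; exact: sqmod_ge0.
Qed.

End rows.

(** * Bounded measurable complex functions and matrix entries *)

Section bounded_measurable_complex.
Context {disp} {T : measurableType disp} {R : realType}.
Implicit Types f g : T -> R[i].

Definition cbmfun f :=
  bmfun (fun x => complex.Re (f x)) /\ bmfun (fun x => complex.Im (f x)).

Lemma cbmfun_cst (c : R[i]) : cbmfun (fun=> c).
Proof. by split; exact: bmfun_cst. Qed.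

Lemma cbmfunD f g : cbmfun f -> cbmfun g -> cbmfun (fun x => f x + g x).
Proof.
move=> [rf jf] [rg jg]; split; under eq_fun do rewrite raddfD; exact: bmfunD.
Qed.

Lemma cbmfunM f g : cbmfun f -> cbmfun g -> cbmfun (fun x => f x * g x).
Proof.
move=> [rf jf] [rg jg]; split.
  rewrite (_ : (fun x => _) = fun x => complex.Re (f x) * complex.Re (g x) -
    complex.Im (f x) * complex.Im (g x)); first by apply: bmfunB; exact: bmfunM.
  by apply/funext => x; case: (f x) (g x) => [a b] [c e].
rewrite (_ : (fun x => _) = fun x => complex.Re (f x) * complex.Im (g x) +
  complex.Im (f x) * complex.Re (g x)); first by apply: bmfunD; exact: bmfunM.
by apply/funext => x; case: (f x) (g x) => [a b] [c e].
Qed.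

Lemma cbmfunJ f : cbmfun f -> cbmfun (fun x => (f x)^*%C).
Proof.
move=> [rf jf]; split.
  by rewrite (_ : (fun x => _) = fun x => complex.Re (f x))//;
    apply/funext => x; case: (f x).
rewrite (_ : (fun x => _) = fun x => - complex.Im (f x)); first exact: bmfunN.
by apply/funext => x; case: (f x).
Qed.

Lemma cbmfun_sum (I : Type) (r : seq I) (F : I -> T -> R[i]) :
  (forall i, cbmfun (F i)) -> cbmfun (fun x => \sum_(i <- r) F i x).
Proof.
move=> bF; elim: r => [|i r IH].
  by under eq_fun do rewrite big_nil; exact: cbmfun_cst.
by under eq_fun do rewrite big_cons; exact: cbmfunD.
Qed.

Lemma bmfun_sqmod f : cbmfun f -> bmfun (fun x => sqmod (f x)).
Proof. by move=> [rf jf]; apply: bmfunD; exact: bmfunX. Qed.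

Lemma cbmfun_SU_coord d (f : T -> SU R d) i j :
  measurable_fun setT f -> cbmfun (fun x => f x i j).
Proof.
move=> mf; have le1 (a b : R) : a ^+ 2 + b ^+ 2 <= 1 -> `|a| <= 1.
  by move=> ab; rewrite -(@expr_le1 _ 2)// real_normK ?num_real//; nra.
split.
  split; first exact: (measurableT_comp (measurable_SU_Re i j) mf).
  by exists 1 => x; exact: le1 (sqmod_SU_le1 _ _ _).
split; first exact: (measurableT_comp (measurable_SU_Im i j) mf).
by exists 1 => x; apply: le1; rewrite addrC; exact: sqmod_SU_le1.
Qed.

End bounded_measurable_complex.

(** * Invariance of Haar integrals under left translation *)

Section haar_invariance.
Variables (R : realType) (d : nat) (haar : probability (SU R d) R).
Hypothesis haarP : is_haar haar.

(** Change of variables to the pushforward of [haar] by [SUmul V], which agrees with [haar] on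
    measurable sets by [haarP]. *)
Lemma Rintegral_haarM (V : SU R d) (f : SU R d -> R) : bmfun f ->
  \int[haar]_U f (SUmul V U) = \int[haar]_U f U.
Proof.
move=> bf; rewrite /Rintegral; congr fine.
have mV := measurable_SUmul V.
transitivity (\int[pushforward haar (SUmul V)]_U (f U)%:E)%E.
  have mf : measurable_fun setT (EFin \o f).
    by case: bf => mf _; exact/measurable_EFinP.
  rewrite (integral_pushforward mV mf)//.
  exact: (bmfun_integrable _ (bmfun_comp mV bf)).
apply: eq_measure_integral => /= A mA _.
exact: haarP.
Qed.

End haar_invariance.

(** * Haar moments of squared amplitudes *)

Section special_unitary_row.
Variables (R : realType) (d : nat).
Hypothesis d2 : (2 <= d)%N.

Definition row0 : 'I_d := Ordinal (ltnW d2).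
Definition row1 : 'I_d := Ordinal d2.

(* Gram-Schmidt provides a unitary matrix with such a first row; rescaling its
   second row, which exists as d >= 2, makes the determinant 1. *)
Lemma row_SU (r : 'rV[R[i]]_d) :
  exists (P : SU R d) (c : R[i]), r = c *: row row0 P.
Proof.
(* All rows equal [r], but only the first matters: [schmidt] returns a unitary matrix whose first
   row spans [r]. *)
pose A : 'M[R[i]]_d := \matrix_(i, j) r 0 j.
pose S := schmidt A.
have uS : S \is unitarymx by exact: schmidt_unitarymx.
have [c rc] : exists c, r = c *: row row0 S.
  apply/sub_rVP; have := row_schmidt_sub A row0.
  rewrite (big_pred1 row0) => [|k]; last by rewrite /= leqn0.
  rewrite genmxE; congr (_ <= _)%MS.
  by apply/rowP => j; rewrite !mxE.
have dS : \det S * (\det S)^*%C = 1.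
  have /unitarymxP/(congr1 determinant) := uS.
  by rewrite det_mulmx det1 det_map_mx det_tr.
pose D : 'rV[R[i]]_d := \row_j (if j == row1 then (\det S)^*%C else 1).
have uD : diag_mx D \is unitarymx.
  apply/unitarymxP; apply/matrixP => i j; rewrite mul_diag_mx !mxE.
  have [->|ij] := eqVneq j i; last by rewrite mulr0n conjC0 mulr0.
  rewrite !mulr1n; case: ifP => _.
    by rewrite conjCE conjcK mulrC.
  by rewrite conjC1 mulr1.
have dD : \det (diag_mx D) = (\det S)^*%C.
  rewrite det_diag (bigD1 row1)//= mxE eqxx big1 ?mulr1// => k ki.
  by rewrite mxE (negbTE ki).
have DS : (diag_mx D *m S \is unitarymx) && (\det (diag_mx D *m S) == 1).
  apply/andP; split; first exact: mul_unitarymx uD uS.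
  by rewrite det_mulmx dD mulrC dS.
have row0E : row row0 (diag_mx D *m S) = row row0 S.
  apply/rowP => j; rewrite mul_diag_mx !mxE (_ : (row0 == row1) = false)//.
  by rewrite mul1r.
exists (MkSU DS), c; rewrite [LHS]rc; congr (_ *: _).
exact: esym row0E.
Qed.

End special_unitary_row.

Section moments.
Variables (R : realType) (d : nat) (haar : probability (SU R d) R).
Variable e0 : 'cV[R[i]]_d.
Hypothesis d2 : (2 <= d)%N.
Hypothesis haarP : is_haar haar.
Hypothesis e0P : unit_ket e0.
Implicit Types v w r : 'rV[R[i]]_d.

Local Notation q v U := (sqmod (amp v (ket e0 U))).

Lemma cbmfun_amp_ket v : cbmfun (fun U : SU R d => amp v (ket e0 U)).
Proof.
rewrite /amp /ket; under eq_fun do rewrite mxE.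
apply: cbmfun_sum => i; apply: cbmfunM; first exact: cbmfun_cst.
under eq_fun do rewrite mxE.
apply: cbmfun_sum => j; apply: cbmfunM; last exact: cbmfun_cst.
exact: cbmfun_SU_coord.
Qed.

Lemma bmfun_sqamp v : bmfun (fun U => q v U).
Proof. exact/bmfun_sqmod/cbmfun_amp_ket. Qed.

Definition moment m : R := \int[haar]_U q (delta_mx 0 (row0 d2)) U ^+ m.

(** Writing [r] as [c] times the first row of [P], its amplitude at [U] is [c] times the first
    coordinate of [P U e0]; invariance absorbs [P], and [sqmod c] is [rsq r]. *)
Lemma Rintegral_sqampX r m : \int[haar]_U q r U ^+ m = moment m * rsq r ^+ m.
Proof.
have [P [c ->]] := row_SU d2 r.
have /andP[uP _] := SUmxP P.
rewrite rsqZ (rsq_row_unitary _ uP) mulr1 mulrC.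
rewrite -Rintegral_bmfunZl; last exact/bmfunX/bmfun_sqamp.
rewrite -[RHS](Rintegral_haarM haarP P); last first.
  exact: bmfunM (bmfun_cst _) (bmfunX m (bmfun_sqamp _)).
apply: eq_Rintegral => U _.
rewrite -exprMn -sqmodM; congr (sqmod _ ^+ _).
by rewrite /amp /ket rowE -scalemxAl [LHS]mxE /= !mulmxA.
Qed.

Lemma moment0 : moment 0 = 1.
Proof.
rewrite /moment; under eq_Rintegral do rewrite expr0.
exact: Rintegral_probability_cst.
Qed.

Lemma Rintegral_sqampXM v w m : rsq v = 1 -> rsq w = 1 ->
  m.+1%:R * \int[haar]_U (q v U ^+ m * q w U) =
  moment m.+1 * (1 + m%:R * sqmod (rdot v w)).
Proof.
move=> v1 w1.
(* With [g] equal to [Re] or [Im], [b] is the linear coefficient in [t] of the squared amplitude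
   along the real or imaginary direction; [p] and [p0] are the [m+1]-st powers of the squared
   amplitude and of the squared norm. *)
pose b (g : R[i] -> R) U := g (amp v (ket e0 U) * (amp w (ket e0 U))^*%C) * 2.
pose p (g : R[i] -> R) U := quad (q v U) (b g U) (q w U) ^+ m.+1.
pose p0 (g : R[i] -> R) : {poly R} := quad 1 (g (rdot v w) * 2) 1 ^+ m.+1.
have [bRe bIm] := cbmfunM (cbmfun_amp_ket v) (cbmfunJ (cbmfun_amp_ket w)).
have bp g : bmfun (b g) -> forall k, bmfun (fun U => (p g U)`_k).
  move=> bb; apply: bmfun_coefX => -[|[|[|k]]];
    under eq_fun do rewrite coef_quad/=.
  - exact: bmfun_sqamp.
  - exact: bb.
  - exact: bmfun_sqamp.
  - by under eq_fun do rewrite nth_nil; exact: bmfun_cst.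
have bbRe : bmfun (b (@complex.Re R)).
  by apply: bmfunM => //; exact: bmfun_cst.
have bbIm : bmfun (b (@complex.Im R)).
  by apply: bmfunM => //; exact: bmfun_cst.
have coefE g : bmfun (b g) ->
    (forall t, exists z,
      (forall U, q (v + z *: w) U = (quad (q v U) (b g U) (q w U)).[t]) /\
      rsq (v + z *: w) = (quad 1 (g (rdot v w) * 2) 1).[t]) ->
    \int[haar]_U (p g U)`_2 = moment m.+1 * (p0 g)`_2.
  move=> bb hz; rewrite -coefZ.
  apply: (@Rintegral_coef _ _ _ haar (p g) _ (2 * m.+1).+1).
  - exact: bp.
  - by move=> U; exact: size_quadX.
  - move=> t; have [z [zq zr]] := hz t.
    rewrite hornerZ horner_exp -zr -Rintegral_sqampX.
    by apply: eq_Rintegral => U _; rewrite horner_exp -zq.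
have hRe : \int[haar]_U (p (@complex.Re R) U)`_2 =
    moment m.+1 * (p0 (@complex.Re R))`_2.
  apply: coefE bbRe _ => t; exists t%:C.
  split; last by rewrite horner_quad rsqDr v1 w1.
  by move=> U; rewrite horner_quad ampDl sqmodDr.
have hIm : \int[haar]_U (p (@complex.Im R) U)`_2 =
    moment m.+1 * (p0 (@complex.Im R))`_2.
  apply: coefE bbIm _ => t; exists (t *i).
  split; last by rewrite horner_quad rsqDi v1 w1.
  by move=> U; rewrite horner_quad ampDl sqmodDi.
(* Adding the two directions merges the squares of [Re z] and [Im z] into [sqmod z]. *)
have coefD (z : R[i]) (a c : R) :
    (quad a (complex.Re z * 2) c ^+ m.+1)`_2 +
    (quad a (complex.Im z * 2) c ^+ m.+1)`_2 =
    2 * m.+1%:R * (a ^+ m * c + m%:R * a ^+ m.-1 * sqmod z).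
  have bin2E : 'C(m.+1, 2)%:R * 2 = m.+1%:R * m%:R :> R.
    by rewrite -!natrM mulnC -mul_bin_diag bin1.
  rewrite !coef2_quadX /sqmod; transitivity (2 * (m.+1%:R * a ^+ m) * c +
      2 * ('C(m.+1, 2)%:R * 2) * a ^+ m.-1 *
        (complex.Re z ^+ 2 + complex.Im z ^+ 2)); first by ring.
  by rewrite bin2E; ring.
have h := congr2 +%R hRe hIm.
rewrite -mulrDr [in RHS]/p0 coefD !expr1n in h.
rewrite -Rintegral_bmfunD in h; [|exact: bp|exact: bp].
have m0 : 2 * m.+1%:R != 0 :> R by rewrite mulf_neq0// pnatr_eq0.
apply: (mulfI m0); transitivity
    (\int[haar]_U ((p (@complex.Re R) U)`_2 + (p (@complex.Im R) U)`_2)).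
  rewrite mulrA -Rintegral_bmfunZl; last first.
    by apply: bmfunM; [exact/bmfunX/bmfun_sqamp|exact: bmfun_sqamp].
  (* Here the cross term has squared modulus [q v U * q w U], so the two summands are [1] and [m]
     times [q v U ^+ m * q w U], which gives the factor [m+1]. The case [m = 0] is split off because
     of [m.-1]. *)
  apply: eq_Rintegral => U _; rewrite /p /b coefD sqmodM sqmodJ.
  by case: m {p p0 bp coefE hRe hIm h m0 coefD} => [|m] /=;
    rewrite -?[m.+2%:R]natr1 ?exprS; ring.
by rewrite h; ring.
Qed.

Lemma sqmod_ket_sum (U : SU R d) : \sum_j sqmod (ket e0 U j 0) = 1.
Proof.
have /andP[uU _] := SUmxP U.
have uUV : U^t* *m U = 1%:M.
  by apply/mulmx1C/unitarymxP.
apply: complexI; rewrite rmorph_sum/=; transitivity (braket e0 e0) => //.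
transitivity (braket (ket e0 U) (ket e0 U)).
  rewrite /braket mxE; apply: eq_bigr => j _.
  by rewrite !mxE mulrC; exact: sqmodE.
rewrite /braket /ket trmx_mul map_mxM -mulmxA.
by rewrite (mulmxA _ U) uUV mul1mx.
Qed.

Lemma momentS m : m.+1%:R * moment m = moment m.+1 * (d%:R + m%:R).
Proof.
pose v : 'rV[R[i]]_d := delta_mx 0 (row0 d2).
have sqv : \sum_j sqmod (v 0 j) = 1 := rsq_delta _ (row0 d2).
(* The ket has norm one, so the sum of its squared coordinates can be inserted; each term is then a
   mixed moment with a standard basis row. *)
transitivity (\sum_j m.+1%:R * \int[haar]_U (q v U ^+ m * q (delta_mx 0 j) U)).
  rewrite -mulr_sumr; congr (_ * _); rewrite -Rintegral_bmfun_sum; last first.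
    by move=> j; apply: bmfunM; [exact/bmfunX/bmfun_sqamp|exact: bmfun_sqamp].
  apply: eq_Rintegral => U _; rewrite -mulr_sumr.
  by under eq_bigr do rewrite amp_delta; rewrite sqmod_ket_sum mulr1.
under eq_bigr => j _.
  rewrite (Rintegral_sqampXM m (rsq_delta _ _) (rsq_delta _ _)) rdot_delta.
  over.
rewrite -mulr_sumr; congr (_ * _).
by rewrite big_split/= -mulr_sumr sqv mulr1 sumr_const card_ord.
Qed.

(** [momentS] is the recursion of inverse binomials, so the prefactors of [outcome_density] are
    exactly its normalization constants. *)
Lemma momentE m : 'C(m + d - 1, d - 1)%:R * moment m = 1.
Proof.
elim: m => [|m IH]; first by rewrite moment0 mulr1 add0n binn.
have m0 : m.+1%:R != 0 :> R by rewrite pnatr_eq0.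
apply: (mulfI m0); rewrite mulr1 mulrA -natrM.
have -> : (m.+1 * 'C(m.+1 + d - 1, d - 1) = (d + m) * 'C(m + d - 1, d - 1))%N.
  have -> : (m.+1 + d - 1 = d + m)%N by rewrite addSn subn1 addnC.
  have -> : (m + d - 1 = (d + m).-1)%N by rewrite subn1 addnC.
  by rewrite mul_bin_down subnBA ?(ltnW d2)// addn1 -addnS addKn.
by rewrite natrM natrD mulrC mulrA -momentS -mulrA (mulrC (moment m)) IH mulr1.
Qed.

Lemma overlapE (phi psi : 'cV[R[i]]_d) :
  overlap phi psi = sqmod (amp (phi ^t*) psi).
Proof. exact: normc_sqr. Qed.

Lemma overlapC (phi psi : 'cV[R[i]]_d) : overlap phi psi = overlap psi phi.
Proof.
rewrite !overlapE -sqmodJ; congr sqmod.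
rewrite /amp !mxE rmorph_sum; apply: eq_bigr => j _.
by rewrite rmorphM !mxE/= conjcK mulrC.
Qed.

Lemma unit_ket_rsq (phi : 'cV[R[i]]_d) : unit_ket phi -> rsq (phi ^t*) = 1.
Proof.
move=> p1; apply: complexI; rewrite rsqE rdotE.
transitivity (braket phi phi) => //.
rewrite /braket mxE; apply: eq_bigr => j _.
by rewrite !mxE/= conjCE conjcK.
Qed.

Lemma ket_unit (U : SU R d) : unit_ket (ket e0 U).
Proof.
rewrite /unit_ket; transitivity ((\sum_j sqmod (ket e0 U j 0))%:C).
  rewrite /braket mxE rmorph_sum; apply: eq_bigr => j _.
  by rewrite !mxE mulrC; exact/esym/sqmodE.
by rewrite sqmod_ket_sum.
Qed.

Lemma Rintegral_overlapX phi m : unit_ket phi ->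
  \int[haar]_U (overlap phi (ket e0 U) ^+ m) = moment m.
Proof.
move=> p1; under eq_Rintegral do rewrite overlapE.
by rewrite Rintegral_sqampX unit_ket_rsq// expr1n mulr1.
Qed.

(** [momentS] trades [moment m.+1] for [moment m], which the binomial prefactor cancels. Integrating
    out one state thus replaces an overlap by an affine function of another overlap. *)
Lemma Rintegral_overlapXM phi psi m : unit_ket phi -> unit_ket psi ->
  \int[haar]_U (overlap phi (ket e0 U) ^+ m * overlap psi (ket e0 U)) =
  moment m * ((1 + m%:R * overlap phi psi) / (d%:R + m%:R)).
Proof.
move=> p1 p2; under eq_Rintegral do rewrite !overlapE.
have m0 : m.+1%:R != 0 :> R by rewrite pnatr_eq0.
have dm0 : d%:R + m%:R != 0 :> R.
  by rewrite -natrD pnatr_eq0 addn_eq0 -leqn0 leqNgt (ltnW d2).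
apply: (mulfI m0); rewrite Rintegral_sqampXM ?unit_ket_rsq//.
rewrite (mulrA m.+1%:R (moment m)) momentS.
have -> : sqmod (rdot (phi ^t*) (psi ^t*)) = overlap phi psi.
  rewrite overlapE /rdot; congr (sqmod (amp _ _)).
  by apply/matrixP => i j; rewrite !mxE; exact: conjcK.
by rewrite -[RHS]mulrA; congr (_ * _); rewrite [RHS]mulrC divfK.
Qed.

End moments.

(** * Bayes estimation with quadratic loss *)

Section bayes.
Context d1 d2 (S : measurableType d1) (T : measurableType d2) (R : realType).
Variables (P : probability S R) (Q : probability T R).

(** Measurability comes from Fubini, and the bound [K] survives because [P] has mass one. *)
Lemma bmfun_Rintegral2 (f : S * T -> R) : bmfun f ->
  bmfun (fun y => \int[P]_x f (x, y)).
Proof.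
move=> bf; split.
  apply/measurable_EFinP.
  have := measurable_fubini_G (bmfun_integrable (P \x Q)%E bf).
  congr (measurable_fun _ _); apply/funext => y.
  by rewrite /= EFin_Rintegral_bmfun//; exact: bmfun_pair2.
have [_ [K fK]] := bf; exists K => y; have bfy := bmfun_pair2 bf y.
rewrite (le_trans (le_normr_Rintegral _ (bmfun_integrable P bfy)))//.
rewrite -[leRHS](Rintegral_probability_cst P); apply: le_Rintegral => //.
- apply: (bmfun_integrable P (f := fun x => `|f (x, y)|)); split.
    by apply: measurableT_comp => //; case: bfy.
  by exists K => x; rewrite normr_id.
- exact: (bmfun_integrable P (bmfun_cst K)).
Qed.

Variables (p : S * T -> R) (c : S -> R).
Hypothesis bp : bmfun p.
Hypothesis bc : bmfun c.
Hypothesis p_ge0 : forall z, 0 <= p z.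
Hypothesis p_marginal1 : forall s, \int[Q]_o p (s, o) = 1.
Hypothesis p_marginal2 : forall o, \int[P]_s p (s, o) = 1.

(** The usual denominator is 1 by [p_marginal2]. *)
Definition cond_mean (o : T) : R := \int[P]_s (c s * p (s, o)).

Definition mse (f : T -> R) : \bar R :=
  (\int[P]_s \int[Q]_o (p (s, o) * (f o - c s) ^+ 2)%:E)%E.

Let c2 (o : T) : R := \int[P]_s (c s ^+ 2 * p (s, o)).

Let bcfst : bmfun (fun z : S * T => c z.1).
Proof. exact: (bmfun_comp measurable_fst bc). Qed.

Lemma bmfun_cond_mean : bmfun cond_mean.
Proof.
by apply: (bmfun_Rintegral2 (f := fun z => c z.1 * p z)); exact: bmfunM.
Qed.

Let bc2 : bmfun c2.
Proof.
apply: (bmfun_Rintegral2 (f := fun z => c z.1 ^+ 2 * p z)).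
by apply: bmfunM => //; exact: bmfunX.
Qed.

Let bp2 o : bmfun (fun s => p (s, o)).
Proof. exact: bmfun_pair2. Qed.

(** Bias-variance decomposition under the posterior density, whose total mass is 1. *)
Lemma conditional_risk (a : R) o :
  \int[P]_s (p (s, o) * (a - c s) ^+ 2) =
  (a - cond_mean o) ^+ 2 + (c2 o - cond_mean o ^+ 2).
Proof.
transitivity (\int[P]_s (a ^+ 2 * p (s, o) +
   ((- (2 * a)) * (c s * p (s, o)) + c s ^+ 2 * p (s, o)))).
  by apply: eq_Rintegral => s _; ring.
have b1 := bmfunM bc (bp2 o).
have b2 := bmfunM (bmfunX 2 bc) (bp2 o).
have b3 k := bmfunM (bmfun_cst k) b1.
rewrite Rintegral_bmfunD; [|exact: bmfunM (bmfun_cst _) (bp2 o)|exact: bmfunD].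
rewrite Rintegral_bmfunD// !Rintegral_bmfunZl// p_marginal2.
by rewrite -/(c2 o) -/(cond_mean o); ring.
Qed.

(** The posterior risk at [a = cond_mean o] is the variance alone, and its integrand is
    nonnegative. *)
Lemma cond_variance_ge0 o : 0 <= c2 o - cond_mean o ^+ 2.
Proof.
have := conditional_risk (cond_mean o) o; rewrite subrr expr0n add0r => <-.
by apply: Rintegral_ge0 => s _; rewrite mulr_ge0// sqr_ge0.
Qed.

Definition bayes_risk : R :=
  \int[P]_s (c s ^+ 2) - \int[Q]_o (cond_mean o ^+ 2).

Lemma integral_cond_variance :
  (\int[Q]_o (c2 o - cond_mean o ^+ 2)%:E)%E = bayes_risk%:E.
Proof.
have b1 := bmfunX 2 bmfun_cond_mean.
rewrite -EFin_Rintegral_bmfun; last exact: bmfunB.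
congr (_%:E); rewrite RintegralB//; [|exact: bmfun_integrable..].
congr (_ - _); rewrite /c2.
have bf : bmfun (fun z : S * T => c z.1 ^+ 2 * p z).
  by apply: bmfunM => //; exact: bmfunX.
rewrite -(Rintegral_fubini2 P Q bf) (Rintegral_fubini1 P Q bf) /=.
apply: eq_Rintegral => s _.
by rewrite Rintegral_bmfunZl ?p_marginal1 ?mulr1//; exact: bmfun_pair1.
Qed.

(** [f] is only measurable, so its risk may be infinite: Tonelli for nonnegative extended-real
    integrands puts the [s] integral inside, where [conditional_risk] splits it. *)
Lemma mseE f : measurable_fun setT f ->
  mse f = (\int[Q]_o ((f o - cond_mean o) ^+ 2)%:E + bayes_risk%:E)%E.
Proof.
move=> mf; have [[mp _] [mc _]] := (bp, bcfst).
have [mm _] := bmfun_cond_mean.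
have mF : measurable_fun setT
    (fun z : S * T => (p z * (f z.2 - c z.1) ^+ 2)%:E).
  apply/measurable_EFinP; apply: measurable_funM => //.
  apply: measurable_funX; apply: measurable_funB => //.
  exact: (measurableT_comp mf measurable_snd).
have F_ge0 z : (0 <= (p z * (f z.2 - c z.1) ^+ 2)%:E)%E.
  by rewrite lee_fin mulr_ge0// sqr_ge0.
rewrite /mse (fubini_tonelli (m1 := P) (m2 := Q) _ mF F_ge0)/=.
rewrite -integral_cond_variance -ge0_integralD//; first last.
- by apply/measurable_EFinP; case: (bmfunB bc2 (bmfunX 2 bmfun_cond_mean)).
- by move=> o _; rewrite lee_fin cond_variance_ge0.
- by apply/measurable_EFinP/measurable_funX/measurable_funB.
- by move=> o _; rewrite lee_fin sqr_ge0.
apply: eq_integral => o _.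
rewrite -EFinD -conditional_risk EFin_Rintegral_bmfun//.
by apply: bmfunM => //; apply: bmfunX; apply: bmfunB => //; exact: bmfun_cst.
Qed.

Lemma mse_cond_mean : mse cond_mean = bayes_risk%:E.
Proof.
rewrite mseE; last by case: bmfun_cond_mean.
by under eq_integral do rewrite subrr expr0n; rewrite integral0 add0e.
Qed.

Lemma mse_cond_mean_le f : measurable_fun setT f -> (mse cond_mean <= mse f)%E.
Proof.
move=> mf; rewrite mse_cond_mean mseE// leeDr//.
by apply: integral_ge0 => o _; rewrite lee_fin sqr_ge0.
Qed.

(** [bayes_risk] is finite and cancels, leaving a nonnegative square with zero integral. *)
Lemma mse_eq_cond_mean f : measurable_fun setT f -> mse f = mse cond_mean ->
  {ae Q, forall o, f o = cond_mean o}.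
Proof.
move=> mf; rewrite mse_cond_mean mseE//.
move=> /(congr1 (fun x => x - bayes_risk%:E)%E).
rewrite addeK// subee// => int0.
have mg : measurable_fun setT (fun o => ((f o - cond_mean o) ^+ 2)%:E).
  apply/measurable_EFinP/measurable_funX/measurable_funB => //.
  by case: bmfun_cond_mean.
have /(ae_eq_integral_abs Q measurableT mg) :
    (\int[Q]_o `|((f o - cond_mean o) ^+ 2)%:E| = 0)%E.
  rewrite -[RHS]int0; apply: eq_integral => o _.
  by rewrite gee0_abs// lee_fin sqr_ge0.
apply: filterS => o /= /(_ Logic.I) [] /eqP.
by rewrite expf_eq0/= subr_eq0 => /eqP.
Qed.

Lemma ereal_inf_mse :
  ereal_inf (mse @` [set f | measurable_fun setT f]) = mse cond_mean.
Proof.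
apply/eqP; rewrite eq_le; apply/andP; split.
  by apply: ereal_inf_lbound; exists cond_mean => //; case: bmfun_cond_mean.
by apply: le_ereal_inf_tmp => _ [f mf <-]; exact: mse_cond_mean_le.
Qed.

End bayes.

(** * The estimate-and-estimate strategy *)

Section covariant_measurements.
Variables (R : realType) (d : nat) (haar : probability (SU R d) R).
Variable e0 : 'cV[R[i]]_d.
Hypothesis d2 : (2 <= d)%N.
Hypothesis haarP : is_haar haar.
Hypothesis e0P : unit_ket e0.
Local Notation SU := (SU R d).
Local Notation ov V U := (overlap (ket e0 V) (ket e0 U)).
Local Notation moment := (moment haar e0 d2).
Local Notation D := (d%:R : R).

Lemma bmfun_overlap disp (T : measurableType disp) (f g : T -> SU) :
  measurable_fun setT f -> measurable_fun setT g ->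
  bmfun (fun x => ov (f x) (g x)).
Proof.
move=> mf mg.
have cket h i : measurable_fun setT h -> cbmfun (fun x : T => ket e0 (h x) i 0).
  move=> mh; rewrite /ket; under eq_fun do rewrite mxE.
  apply: cbmfun_sum => j; apply: cbmfunM; last exact: cbmfun_cst.
  exact: cbmfun_SU_coord.
under eq_fun do rewrite overlapE.
apply: bmfun_sqmod; rewrite /amp; under eq_fun do rewrite mxE.
apply: cbmfun_sum => i; apply: cbmfunM; last exact: cket.
rewrite (_ : (fun x => _) = fun x => (ket e0 (f x) i 0)^*%C).
  exact: cbmfunJ (cket _ _ mf).
by apply/funext => x; rewrite !mxE.
Qed.

Lemma bmfun_overlap_cst V : bmfun (fun U => ov V U).
Proof. by apply: (bmfun_overlap (f := cst V) (g := id)). Qed.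

Lemma Rintegral_ovX V m : \int[haar]_U (ov V U ^+ m) = moment m.
Proof. exact/Rintegral_overlapX/ket_unit. Qed.

Lemma Rintegral_ovXM V W m :
  'C(m + d - 1, d - 1)%:R * \int[haar]_U (ov V U ^+ m * ov W U) =
  (1 + m%:R * ov V W) / (D + m%:R).
Proof.
rewrite (Rintegral_overlapXM d2)//; [|exact: ket_unit..].
by rewrite [LHS](mulrA _ (moment m)) momentE// mul1r.
Qed.

Lemma moment1 : moment 1 = D^-1.
Proof.
have D0 : D != 0 by rewrite pnatr_eq0 -lt0n (ltnW d2).
have := momentS d2 haarP e0P 0; rewrite moment0 mul1r addr0 => E.
by apply: (mulIf D0); rewrite -E mulVf.
Qed.

Lemma moment2 : moment 2 = 2 / (D * (D + 1)).
Proof.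
have D0 : D != 0 by rewrite pnatr_eq0 -lt0n (ltnW d2).
have D1 : D + 1 != 0 by rewrite natr1 pnatr_eq0.
have := momentS d2 haarP e0P 1; rewrite moment1 => E.
by apply: (mulIf D1); rewrite -E; field; rewrite D0 D1.
Qed.

Variables N M : nat.
Local Notation p :=
  (fun z : (SU * SU) * (SU * SU) => outcome_density e0 N M z.1 z.2).
Local Notation c := (state_overlap e0).
Local Notation CM := ('C(M + d - 1, d - 1)%:R : R).
Local Notation CN := ('C(N + d - 1, d - 1)%:R : R).

Lemma bmfun_density : bmfun p.
Proof.
apply: bmfunM; apply: bmfunM (bmfun_cst _) (bmfunX _ _); apply: bmfun_overlap.
- exact: (measurableT_comp measurable_fst measurable_snd).
- exact: (measurableT_comp measurable_snd measurable_fst).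
- exact: (measurableT_comp measurable_snd measurable_snd).
- exact: (measurableT_comp measurable_fst measurable_fst).
Qed.

Lemma bmfun_state_overlap : bmfun c.
Proof. apply: bmfun_overlap; [exact: measurable_fst|exact: measurable_snd]. Qed.

Lemma density_ge0 z : 0 <= p z.
Proof. by rewrite !mulr_ge0// exprn_ge0// overlapE sqmod_ge0. Qed.

Lemma density_marginal1 s : \int[(haar \x haar)%E]_o p (s, o) = 1.
Proof.
rewrite (Rintegral_fubini1 haar haar (bmfun_pair1 bmfun_density s)) /=.
transitivity (\int[haar]_V ((CM * ov s.2 V ^+ M) * (CN * moment N))).
  apply: eq_Rintegral => V _; rewrite /outcome_density /= overlapC.
  rewrite -(Rintegral_ovX s.1 N) -!Rintegral_bmfunZl; first last.
  - exact: bmfunX (bmfun_overlap_cst _).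
  - exact: bmfunM (bmfun_cst _) (bmfunX _ (bmfun_overlap_cst _)).
  by apply: eq_Rintegral => W _; rewrite (overlapC _ (ket e0 s.1)).
rewrite momentE//; under eq_Rintegral do rewrite mulr1.
rewrite Rintegral_bmfunZl ?Rintegral_ovX ?momentE//.
exact: bmfunX (bmfun_overlap_cst _).
Qed.

(** Averaged over the states, the outcomes are again independent and Haar distributed, and the
    denominator of [posterior_mean] is 1. *)
Lemma density_marginal2 o : \int[(haar \x haar)%E]_s p (s, o) = 1.
Proof.
rewrite (Rintegral_fubini1 haar haar (bmfun_pair2 bmfun_density o)) /=.
transitivity (\int[haar]_U ((CN * ov o.2 U ^+ N) * (CM * moment M))).
  apply: eq_Rintegral => U _; rewrite /outcome_density /=.
  rewrite -(Rintegral_ovX o.1 M) -!Rintegral_bmfunZl; first last.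
  - exact: bmfunX (bmfun_overlap_cst _).
  - exact: bmfunM (bmfun_cst _) (bmfunX _ (bmfun_overlap_cst _)).
  by apply: eq_Rintegral => W _; rewrite mulrC.
rewrite momentE//; under eq_Rintegral do rewrite mulr1.
rewrite Rintegral_bmfunZl ?Rintegral_ovX ?momentE//.
exact: bmfunX (bmfun_overlap_cst _).
Qed.

Let DM0 : D + M%:R != 0.
Proof. by rewrite -natrD pnatr_eq0 addn_eq0 -leqn0 leqNgt (ltnW d2). Qed.

Let DN0 : D + N%:R != 0.
Proof. by rewrite -natrD pnatr_eq0 addn_eq0 -leqn0 leqNgt (ltnW d2). Qed.

Lemma cond_mean_density V W :
  cond_mean (haar \x haar)%E p c (V, W) =
  (D + M%:R + N%:R + M%:R * N%:R * ov V W) / ((D + M%:R) * (D + N%:R)).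
Proof.
have bV := bmfun_overlap_cst V; have bW := bmfun_overlap_cst W.
rewrite /cond_mean (Rintegral_fubini1 haar haar); last first.
  exact: (bmfunM bmfun_state_overlap (bmfun_pair2 bmfun_density (V, W))).
rewrite /state_overlap /outcome_density /=.
(* Integrating out [phi] (variable [T]) turns the overlap with [psi] into an affine function of
   [ov V U]; the remaining integral over [psi] (variable [U]) has the same shape with [N] and
   [W]. *)
transitivity (\int[haar]_U ((D + M%:R)^-1 * (CN * ov W U ^+ N) +
   (M%:R / (D + M%:R) * CN) * (ov W U ^+ N * ov V U))).
  apply: eq_Rintegral => U _.
  transitivity (\int[haar]_T
    ((CN * ov W U ^+ N) * (CM * (ov V T ^+ M * ov U T)))).
    by apply: eq_Rintegral => T _; ring.
  have b1 : bmfun (fun T => ov V T ^+ M * ov U T).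
    by apply: bmfunM (bmfunX _ bV) (bmfun_overlap_cst _).
  rewrite !Rintegral_bmfunZl//; last exact: bmfunM (bmfun_cst _) b1.
  by rewrite Rintegral_ovXM; ring.
have bWN := bmfunX N bW.
rewrite Rintegral_bmfunD; last 2 first.
- exact: bmfunM (bmfun_cst _) (bmfunM (bmfun_cst _) bWN).
- exact: bmfunM (bmfun_cst _) (bmfunM bWN bV).
rewrite !Rintegral_bmfunZl//; last 2 first.
- exact: bmfunM bWN bV.
- exact: bmfunM (bmfun_cst _) bWN.
rewrite Rintegral_ovX momentE// -(mulrA (_ / _) CN) Rintegral_ovXM overlapC.
by move: (ov V W) => w; field; rewrite DM0 DN0.
Qed.

Definition ee_risk : R :=
  (D - 1) * (D + M%:R + N%:R) *
    (D ^+ 2 + 2 * M%:R * N%:R + D * (M%:R + N%:R)) /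
  (D * (D + 1) * (D + M%:R) ^+ 2 * (D + N%:R) ^+ 2).

(** Serves both the prior moments of [c] and the moments of [w], since the estimates are averaged
    over the same product measure as the states. *)
Lemma Rintegral_prod_ov (m : nat) :
  \int[(haar \x haar)%E]_o (ov o.1 o.2 ^+ m) = moment m.
Proof.
rewrite (Rintegral_fubini1 haar haar (bmfunX m bmfun_state_overlap)) /=.
under eq_Rintegral do rewrite Rintegral_ovX.
exact: Rintegral_probability_cst.
Qed.

Lemma bayes_risk_density :
  bayes_risk (haar \x haar)%E (haar \x haar)%E p c = ee_risk.
Proof.
have bc := bmfun_state_overlap.
have D0 : D != 0 by rewrite pnatr_eq0 -lt0n (ltnW d2).
have D1 : D + 1 != 0 by rewrite natr1 pnatr_eq0.
(* The posterior mean is [(s + M N w) / K], so its second moment needs only the first two moments of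
   [w]. *)
pose K := (D + M%:R) * (D + N%:R); pose s := D + M%:R + N%:R.
rewrite /bayes_risk Rintegral_prod_ov moment2.
have -> : \int[(haar \x haar)%E]_o (cond_mean (haar \x haar)%E p c o ^+ 2) =
  s ^+ 2 / K ^+ 2 + (2 * s * M%:R * N%:R / K ^+ 2 / D +
    M%:R ^+ 2 * N%:R ^+ 2 / K ^+ 2 * (2 / (D * (D + 1)))).
  transitivity (\int[(haar \x haar)%E]_o (s ^+ 2 / K ^+ 2 +
    ((2 * s * M%:R * N%:R / K ^+ 2) * (c o ^+ 1) +
     (M%:R ^+ 2 * N%:R ^+ 2 / K ^+ 2) * (c o ^+ 2)))).
    apply: eq_Rintegral => -[V W] _.
    rewrite cond_mean_density -/K -/s /state_overlap/=.
    by move: (ov V W) K s => w K s; rewrite expr1 !exprMn exprVn; ring.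
  have b1 k := bmfunM (bmfun_cst k) (bmfunX 1 bc).
  have b2 k := bmfunM (bmfun_cst k) (bmfunX 2 bc).
  rewrite Rintegral_bmfunD; [|exact: bmfun_cst|exact: bmfunD].
  rewrite Rintegral_bmfunD//.
  rewrite (Rintegral_bmfunZl _ _ (bmfunX 1 bc)).
  rewrite (Rintegral_bmfunZl _ _ (bmfunX 2 bc)).
  by rewrite !Rintegral_prod_ov moment1 moment2 Rintegral_probability_cst.
by rewrite /ee_risk /K /s; field; rewrite D0 D1 DM0 DN0.
Qed.

End covariant_measurements.

(** * Asymptotics of the minimal risk as limits of rational functions at 0 *)

Section rational_limits.
Variable R : realType.
Implicit Types D N M x k : R.

(* v_ee as a function of x = 1/M. *)
Definition rate_fixed_N D N x : R :=
  (D - 1) * (D * x + 1 + N * x) * (D ^+ 2 * x + 2 * N + D * (1 + N * x)) /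
  (D * (D + 1) * (D * x + 1) ^+ 2 * (D + N) ^+ 2).

(* The ratio of v_ee to its claimed equivalent as a function of x = 1/(M+N), for
   M - N = k, using 4 M N = (M+N)^2 - k^2. *)
Definition rate_balanced D k x : R :=
  (D * x + 1) * (D ^+ 2 * x ^+ 2 + (1 - k ^+ 2 * x ^+ 2) / 2 + D * x) /
  (8 * (D ^+ 2 * x ^+ 2 + D * x + (1 - k ^+ 2 * x ^+ 2) / 4) ^+ 2).

Lemma cvg_rate_fixed_N D N (u : nat -> R) :
  0 < D -> 0 <= N -> u @ \oo --> (0 : R) ->
  rate_fixed_N D N (u n) @[n --> \oo] -->
    (D - 1) * (D + 2 * N) / (D * (D + 1) * (D + N) ^+ 2).
Proof.
move=> D0 N0 u0; rewrite (_ : _ / _ = rate_fixed_N D N 0); last first.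
  by rewrite /rate_fixed_N !mulr0 !addr0 !add0r; field; lra.
rewrite /rate_fixed_N.
apply: cvgM; last apply: cvgV.
- by repeat (exact: u0 || exact: cvg_cst || apply: cvgM || apply: cvgD).
- by rewrite !mulf_neq0// ?expf_neq0//; lra.
- by repeat (exact: u0 || exact: cvg_cst || apply: cvgM || apply: cvgD).
Qed.

Lemma cvg_rate_balanced D k (u : nat -> R) : u @ \oo --> (0 : R) ->
  rate_balanced D k (u n) @[n --> \oo] --> (1 : R).
Proof.
(* At [x = 0] the ratio is [(1/2) / (8 / 16) = 1]. *)
move=> u0; rewrite (_ : 1 = rate_balanced D k 0); last first.
  by rewrite /rate_balanced; field.
rewrite /rate_balanced.
apply: cvgM; last apply: cvgV.
- by repeat (exact: u0 || exact: cvg_cst || apply: cvgM || apply: cvgB ||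
             apply: cvgD).
- by rewrite !(expr0n, mulr0, add0r, subr0)/= mulf_neq0// expf_neq0//; lra.
- by repeat (exact: u0 || exact: cvg_cst || apply: cvgM || apply: cvgB ||
             apply: cvgD).
Qed.

End rational_limits.

(** * Optimality of the posterior mean, minimal risk and its two limits *)

Theorem mainTheorem10 (R : realType) (d : nat) (haar : probability (SU R d) R)
    (e0 : 'cV[complex R]_d) :
  (2 <= d)%N -> is_haar haar -> unit_ket e0 ->
  let D : R := d%:R in
  [/\ (forall N M : nat, (1 <= N)%N -> (1 <= M)%N ->
        let chat := posterior_mean haar e0 N M in
        let mse := gmse haar e0 N M in
        [/\ estimator chat,
            (forall f, estimator f -> (mse chat <= mse f)%E),
            (forall f, estimator f -> mse f = mse chat ->
               {ae (haar \x haar)%E, forall o, f o = chat o}),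
            (forall V W : SU R d,
               chat (V, W) =
               (D + M%:R + N%:R +
                 M%:R * N%:R * overlap (ket e0 V) (ket e0 W)) /
               ((D + M%:R) * (D + N%:R))) &
            mse chat = min_gmse haar e0 N M /\
            min_gmse haar e0 N M =
              ((D - 1) * (D + M%:R + N%:R) *
                 (D ^+ 2 + 2 * M%:R * N%:R + D * (M%:R + N%:R)) /
               (D * (D + 1) * (D + M%:R) ^+ 2 * (D + N%:R) ^+ 2))%:E]),
      (forall N : nat, (1 <= N)%N ->
        fine (min_gmse haar e0 N M) @[M --> \oo] -->
          (D - 1) * (D + 2 * N%:R) / (D * (D + 1) * (D + N%:R) ^+ 2)) &
      (forall (k : int) (N M : nat -> nat),
        (forall n, (1 <= N n)%N) -> (forall n, (1 <= M n)%N) ->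
        (forall n, (M n)%:Z - (N n)%:Z = k) ->
        (M n + N n)%N @[n --> \oo] --> \oo ->
        (fun n => fine (min_gmse haar e0 (N n) (M n)) : R^o) ~_\oo
        (fun n => 8 * (D - 1) / (D * (D + 1) * (M n + N n)%:R) : R^o))].
Proof.
move=> d2 haarP e0P D.
have chatE N M : posterior_mean haar e0 N M = cond_mean (haar \x haar)%E
    (fun z => outcome_density e0 N M z.1 z.2) (state_overlap e0).
  apply/funext => o; rewrite /posterior_mean /cond_mean/=.
  by have := density_marginal2 d2 haarP e0P N M o => /= ->; rewrite divr1.
have bp N M := bmfun_density e0 N M.
have bc : bmfun (state_overlap e0) := bmfun_state_overlap e0.
have pm1 N M := density_marginal1 d2 haarP e0P N M.
have pm2 N M := density_marginal2 d2 haarP e0P N M.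
have p0 N M := @density_ge0 R d e0 N M.
have minE N M : min_gmse haar e0 N M = (ee_risk R d N M)%:E.
  rewrite -(bayes_risk_density d2 haarP e0P N M).
  rewrite -(mse_cond_mean (bp N M) bc (p0 N M) (pm1 N M) (pm2 N M)).
  exact: (ereal_inf_mse (bp N M) bc (p0 N M) (pm1 N M) (pm2 N M)).
have D0 : 0 < D by rewrite ltr0n (ltnW d2).
have D1 : 0 < D - 1 by rewrite subr_gt0 ltr1n.
split.
- move=> N M _ _ /=; rewrite chatE; split.
  + by case: (bmfun_cond_mean (haar \x haar)%E (haar \x haar)%E (bp N M) bc).
  + exact: (mse_cond_mean_le (bp N M) bc (p0 N M) (pm1 N M) (pm2 N M)).
  + exact: (mse_eq_cond_mean (bp N M) bc (p0 N M) (pm1 N M) (pm2 N M)).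
  + exact: cond_mean_density.
  + split; last exact: minE.
    exact/esym/(ereal_inf_mse (bp N M) bc (p0 N M) (pm1 N M) (pm2 N M)).
(* The shift sets [M = n+1], so [harmonic n] is [1/M] and the singular value [M = 0] is skipped. *)
- move=> N _; rewrite -cvg_shiftS /=.
  rewrite (_ : (fun n => fine _) =
      (fun n => rate_fixed_N D N%:R (harmonic n))).
    exact: cvg_rate_fixed_N D0 (ler0n _ _) cvg_harmonic.
  apply/funext => n; rewrite minE /= /ee_risk /rate_fixed_N -/D.
  have n0 : n.+1%:R != 0 :> R by rewrite pnatr_eq0.
  have n1 : 0 < n.+1%:R :> R by rewrite ltr0n.
  have N0 : 0 <= N%:R :> R by rewrite ler0n.
  rewrite /harmonic; move: n.+1%:R n0 n1 => M M0 M1; field.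
  by rewrite M0 /=; lra.
- move=> k N M N1 M1 Mk S_oo.
  have inv0 : (fun n => n%:R^-1 : R) @ \oo --> (0 : R).
    by rewrite -cvg_shiftS; exact: cvg_harmonic.
  have u0 : (fun n => (M n + N n)%:R^-1 : R) @ \oo --> (0 : R).
    exact: (cvg_comp _ _ S_oo inv0).
  have r1 := cvg_rate_balanced D k%:~R u0.
  (* The risk is [g] times the ratio, so its distance to [g] is [|g| * |ratio - 1|], and a ratio
     tending to 1 gives the little-o bound. *)
  apply/eqaddoP => e e0'; move/cvgrPdist_le : r1 => /(_ _ e0').
  apply: filterS => n; rewrite distrC => rn.
  rewrite !fctE minE /=.
  set g : R := 8 * _ / _.
  have -> : ee_risk R d (N n) (M n) =
      g * rate_balanced D k%:~R (M n + N n)%:R^-1.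
    have -> : k%:~R = (M n)%:R - (N n)%:R :> R by rewrite -(Mk n) rmorphB.
    have m0 : 0 < (M n)%:R :> R by rewrite ltr0n.
    have n0 : 0 < (N n)%:R :> R by rewrite ltr0n.
    rewrite /g /ee_risk /rate_balanced -/D natrD.
    move: (M n)%:R (N n)%:R m0 n0 => m l m0 l0.
    have S0 : m + l != 0 by lra.
    (* Since [(m+l)^2 - (m-l)^2 = 4 m l], the squared denominator factor of [rate_balanced] splits
       into the two factors of [ee_risk]. *)
    have -> : D ^+ 2 * (m + l)^-1 ^+ 2 + D * (m + l)^-1 +
        (1 - (m - l) ^+ 2 * (m + l)^-1 ^+ 2) / 4 =
        (D + m) * (D + l) / (m + l) ^+ 2 by field.
    have Dm : D + m != 0 by lra.
    have Dl : D + l != 0 by lra.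
    have D2 : D + 1 != 0 by lra.
    by field; rewrite S0 Dm Dl D2 lt0r_neq0.
  rewrite -[X in _ - X]mulr1 -mulrBr normrM mulrC ler_wpM2r//.
Qed.
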